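(* Let $\hat H$ be a locally interacting Hamiltonian with a unique (non-degenerate) ground state $|G\rangle$ of energy $E_0$ and spectral gap $\Delta>0$, and let $v$ be its Lieb–Robinson velocity. Let $\hat A_X,\hat B_Y$ be arbitrary local observables with $\|\hat A_X\|=\|\hat B_Y\|=1$, supported on non-overlapping regions $X,Y$ at distance $d_{XY}$. Let $\bar P_G=\hat{\mathds 1}-|G\rangle\langle G|$ and $$f_{XY}\equiv\langle G|\hat A_X\frac{\bar P_G}{E_0-\hat H}\hat B_Y|G\rangle+\mathrm{c.c.}$$ Then $$|f_{XY}|\le C\sqrt{d_{XY}}\,e^{-d_{XY}/\xi},\qquad \xi^{-1}=\begin{cases}\dfrac{\Delta}{2v}&\text{if }\Delta\le v,\\[2mm]\dfrac12W\!\left(\dfrac{\Delta^2e}{v^2}\right)&\text{if }\Delta>v,\end{cases}$$ where $W$ is the Lambert-$W$ function and $C$ is a constant depending on $\hat A_X$ and $\hat B_Y$ (but not on $d_{XY}$).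
   Context: ''Locally interacting'' means $\hat H$ is a sum of bounded terms each acting on a bounded number of neighbouring lattice sites, with finite local Hilbert space. The Lieb–Robinson velocity $v$ is the velocity in a Lieb–Robinson bound for $\hat H$, i.e. a bound on $\|[\hat A_X(t),\hat B_Y]\|$ with $\hat A_X(t)=e^{i\hat Ht}\hat A_Xe^{-i\hat Ht}$ of the form $C'(v|t|/d_{XY})^{d_{XY}+1}$ for $v|t|\le d_{XY}$ (and by $2$ trivially otherwise). $\frac{\bar P_G}{E_0-\hat H}$ denotes the reduced resolvent (inverse of $E_0-\hat H$ on the range of $\bar P_G$, zero on $|G\rangle$). *)

(* Defs.v *)
From HB Require Import structures.
From mathcomp Require Import all_boot all_order all_algebra.
From mathcomp Require Import complex.
From mathcomp Require Import all_classical all_reals all_analysis.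
Set Implicit Arguments. Unset Strict Implicit. Unset Printing Implicit Defensive.
Import Order.TTheory GRing.Theory Num.Theory.
Local Open Scope ring_scope.
Local Open Scope complex_scope.

Section QDefs.
Variable R : realType.
Local Notation C := R[i].

Definition mxadj (m n : nat) (M : 'M[C]_(m, n)) : 'M[C]_(n, m) :=
  (map_mx (@conjc R) M)^T.

Definition unitary_mx (n : nat) (U : 'M[C]_n) : Prop := U *m mxadj U = 1%:M.
Definition hermitian_mx (n : nat) (M : 'M[C]_n) : Prop := mxadj M = M.

Definition cexpi (th : R) : C := (cos th) +i* (sin th).

Definition fcalc (n : nat) (U : 'M[C]_n) (g : 'I_n -> C) : 'M[C]_n :=
  U *m diag_mx (\row_k g k) *m mxadj U.

Definition cabs (z : C) : R :=
  Num.sqrt ((complex.Re z) ^+ 2 + (complex.Im z) ^+ 2).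

Definition vnorm (n : nat) (x : 'cV[C]_n) : R :=
  Num.sqrt (\sum_i ((complex.Re (x i 0)) ^+ 2 + (complex.Im (x i 0)) ^+ 2)).

Definition opnorm (n : nat) (M : 'M[C]_n) : R :=
  sup [set r : R | exists x : 'cV[C]_n, vnorm x <= 1 /\ r = vnorm (M *m x)].

(* Heisenberg evolution A(t) = e^{iHt} A e^{-iHt}, with H = U diag(E) U^dagger *)
Definition heis (n : nat) (U : 'M[C]_n) (E : 'I_n -> R) (t : R) (A : 'M[C]_n)
  : 'M[C]_n :=
  fcalc U (fun k => cexpi (E k * t)) *m A *m fcalc U (fun k => cexpi (- (E k * t))).

Definition commut (n : nat) (A B : 'M[C]_n) : 'M[C]_n := A *m B - B *m A.

Definition expect (n : nat) (psi : 'cV[C]_n) (M : 'M[C]_n) : C :=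
  (mxadj psi *m M *m psi) 0 0.

(* reduced resolvent  Pbar_G / (E0 - H): inverse of E0 - H on the range of Pbar_G,
   zero on |G> = U e_0, for H = U diag(E) U^dagger with E0 = E 0 *)
Definition red_resolvent (n : nat) (U : 'M[C]_n.+1) (E : 'I_n.+1 -> R) : 'M[C]_n.+1 :=
  fcalc U (fun k => if k == ord0 then 0 else ((E ord0 - E k)^-1)%:C).

Definition fXY (n : nat) (U : 'M[C]_n.+1) (E : 'I_n.+1 -> R) (A B : 'M[C]_n.+1) : C :=
  let z := expect (col ord0 U) (A *m red_resolvent U E *m B) in z + z^*.

(* principal branch of the Lambert W function on [0, +oo):
   the w >= 0 with w e^w = x *)
Definition lambertW (x : R) : R :=
  sup [set w : R | 0 <= w /\ w * expR w <= x].

Definition xi_inv (Delta v : R) : R :=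
  if Delta <= v then Delta / (2 * v)
  else lambertW (Delta ^+ 2 * expR 1 / v ^+ 2) / 2.

End QDefs.

(* Main.v *)
Require Import Defs.
From HB Require Import structures.
From mathcomp Require Import all_boot all_order all_algebra.
From mathcomp Require Import complex ring lra.
From mathcomp Require Import all_classical all_reals all_analysis.
Set Implicit Arguments. Unset Strict Implicit. Unset Printing Implicit Defensive.
Import Order.TTheory GRing.Theory Num.Theory.
Import numFieldNormedType.Exports.
Local Open Scope ring_scope.
Local Open Scope complex_scope.

(** With [c_k = <0|A|k><k|B|0>], [x_k = Re c_k] and [w_k = E_k - E_0 >= Delta],
    one has [f_XY = - 2 \sum_k x_k / w_k], while the part of the ground state
    expectation of [[A(t), B]] that is odd in [t] is proportional to
    [\sum_k x_k sin (w_k t)], which the Lieb-Robinson bound controls up to the time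
    [T = d / v], and with it the primitive [P(t) = \sum_k x_k (1 - cos (w_k t)) / w_k].
    Averaging [\sum_k x_k / w_k = P(t) + \sum_k x_k cos (w_k t) / w_k] over [[0, T]]
    with the weight [exp (- a t^2)], the first term is small by the Lieb-Robinson
    bound and the second one because the truncated Gaussian cosine integral is at most
    of order [exp (- w^2 / 4a) + exp (- a T^2)]. With [a = y v^2 / 2d], the choice of
    [y] that balances the errors yields the rate [xi_inv]; the length of the time
    interval divided by the width of the Gaussian yields the factor [sqrt d]. *)

(** * Calculus on the real line *)

Local Ltac simpl_derive := rewrite /= ?scaler0 ?addr0 ?add0r /GRing.scale /=.

Section calculus.
Local Open Scope classical_set_scope.
Variable R : realType.
Implicit Types (f g df dg : R -> R) (a b t : R).
Notation mu := (@lebesgue_measure R).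

Lemma is_derive_continuous f df :
  (forall t, is_derive t 1 f (df t)) -> continuous f.
Proof.
move=> fdf t; apply: differentiable_continuous; apply/derivable1_diffP.
by have [] := fdf t.
Qed.

Lemma is_derive_LRcontinuous f df a b :
  (forall t, is_derive t 1 f (df t)) -> derivable_oo_LRcontinuous f a b.
Proof.
move=> fdf; have cf := is_derive_continuous fdf; split.
- by move=> t _; have [] := fdf t.
- exact/cvg_at_right_filter/cf.
- exact/cvg_at_left_filter/cf.
Qed.

Lemma is_derive_ge0_le f df a b : a <= b ->
  (forall t, is_derive t 1 f (df t)) -> (forall t, a <= t <= b -> 0 <= df t) ->
  f a <= f b.
Proof.
move=> ab fdf df0.
have [c] := MVT_segment ab (fun t _ => fdf t)
  (continuous_subspaceT (is_derive_continuous fdf)).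
rewrite in_itv /= => cab fE.
by rewrite -subr_ge0 fE mulr_ge0 ?df0 ?subr_ge0.
Qed.

Lemma normB_le_derive f g df dg a b : a <= b ->
  (forall t, is_derive t 1 f (df t)) -> (forall t, is_derive t 1 g (dg t)) ->
  (forall t, a <= t <= b -> `|df t| <= dg t) ->
  `|f b - f a| <= g b - g a.
Proof.
move=> ab fdf gdg df_dg.
have gBf : (g - f) a <= (g - f) b.
  apply: (is_derive_ge0_le ab (fun t => is_deriveB (gdg t) (fdf t))) => t.
  by move=> /df_dg; rewrite ler_norml subr_ge0 => /andP[].
have gDf : (g + f) a <= (g + f) b.
  apply: (is_derive_ge0_le ab (fun t => is_deriveD (gdg t) (fdf t))) => t.
  by move=> /df_dg; rewrite ler_norml => /andP[]; lra.
by move: gBf gDf; rewrite !fctE ler_norml => ? ?; apply/andP; split; lra.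
Qed.

Lemma continuous_sum (n : nat) (f : 'I_n -> R -> R) :
  (forall i, continuous (f i)) -> continuous (fun t => \sum_i f i t).
Proof.
by move=> cf t; apply: cvg_big => [|i _]; [exact: add_continuous|exact: cf].
Qed.

Lemma continuous_integrable_itv f a b :
  continuous f -> mu.-integrable `[a, b] (EFin \o f).
Proof.
move=> cf; apply: continuous_compact_integrable; first exact: segment_compact.
exact: continuous_subspaceT.
Qed.

Lemma Rintegral_sum (n : nat) (f : 'I_n -> R -> R) a b :
  (forall i, continuous (f i)) ->
  \int[mu]_(t in `[a, b]) (\sum_i f i t) = \sum_i \int[mu]_(t in `[a, b]) f i t.
Proof.
move=> cf; have intf i := continuous_integrable_itv a b (cf i).
rewrite /Rintegral; under eq_integral do rewrite -sumEFin.
rewrite integral_sum// sum_fine// => i _.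
exact: (integrable_fin_num _ (intf i)).
Qed.

Lemma Rintegral_itv_cst a b (r : R) : a <= b ->
  \int[mu]_(t in `[a, b]) r = r * (b - a).
Proof.
move=> ab; rewrite Rintegral_cst//= lebesgue_measure_itv /= lte_fin.
by case: ltP => //= ba; rewrite (@le_anti _ _ a b) ?ab ?subrr.
Qed.

Lemma le_Rintegral_continuous f g a b : continuous f -> continuous g ->
  (forall t, a <= t <= b -> f t <= g t) ->
  \int[mu]_(t in `[a, b]) f t <= \int[mu]_(t in `[a, b]) g t.
Proof.
by move=> cf cg fg; apply: le_Rintegral => //; exact: continuous_integrable_itv.
Qed.

Lemma norm_Rintegral_itv_le f a b (M : R) : a <= b -> continuous f ->
  (forall t, a <= t <= b -> `|f t| <= M) ->
  `|\int[mu]_(t in `[a, b]) f t| <= M * (b - a).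
Proof.
move=> ab cf fM; apply: (le_trans (le_normr_Rintegral _ _)) => //.
  exact: continuous_integrable_itv.
rewrite -Rintegral_itv_cst//; apply: le_Rintegral_continuous => // t.
  exact: continuous_comp (cf t) (@norm_continuous _ _ _).
exact: cvg_cst.
Qed.

End calculus.

(** * Filtering a sum of oscillations *)

Section time_filter.
Local Open Scope classical_set_scope.
Variables (R : realType) (g : R -> R) (T : R).
Hypothesis cg : continuous g.
Implicit Types s t w : R.
Notation mu := (@lebesgue_measure R).

Definition cos_transform w : R := \int[mu]_(t in `[0, T]) (g t * cos (w * t)).

Definition sin_moment w : R := \int[mu]_(t in `[0, T]) (t * g t * sin (w * t)).

Lemma continuous_mul_cos w : continuous (fun t => g t * cos (w * t)).
Proof.
move=> t; apply: cvgM; first exact: cg.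
by apply: (@is_derive_continuous _ (fun t => cos (w * t))).
Qed.

Lemma continuous_mul_sin w : continuous (fun t => t * g t * sin (w * t)).
Proof.
move=> t; apply: cvgM; first by apply: cvgM; [exact: cvg_id|exact: cg].
by apply: (@is_derive_continuous _ (fun t => sin (w * t))).
Qed.

Lemma is_derive_cos_transform w :
  is_derive w 1 cos_transform (- sin_moment w).
Proof.
pose f s t := g t * cos (s * t).
have df s t : is_derive s 1 (f ^~ t) (- (t * g t * sin (s * t))).
  apply: is_derive_eq; simpl_derive; ring.
have d1f s t : partial1of2 f s t = - (t * g t * sin (s * t)).
  by rewrite partial1of2E; have [] := df s t.
have w_itv : (`]w - 1, w + 1[ : set R) w by rewrite /= in_itv /=; lra.
have intf s : (`]w - 1, w + 1[ : set R) s -> mu.-integrable `[0, T] (EFin \o f s).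
  by move=> _; apply: continuous_integrable_itv; exact: continuous_mul_cos.
have derf s t : (`]w - 1, w + 1[ : set R) s -> (`[0, T] : set R) t ->
    derivable (f ^~ t) s 1 by move=> _ _; have [] := df s t.
have int_dom : mu.-integrable `[0, T] (EFin \o (fun t => `|t * g t|)).
  apply: continuous_integrable_itv => t.
  apply: (@continuous_comp _ _ _ (fun t => t * g t)); last exact: norm_continuous.
  by apply: cvgM; [exact: cvg_id|exact: cg].
have d1f_le s t : (`]w - 1, w + 1[ : set R) s -> (`[0, T] : set R) t ->
    `|partial1of2 f s t| <= `|t * g t|.
  by move=> _ _; rewrite d1f normrN normrM ler_piMr// ler_norml sin_geN1 sin_le1.
apply: DeriveDef.
  exact: (derivable_under_integral _ w_itv intf derf _ int_dom d1f_le).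
rewrite -derive1E (differentiation_under_integral _ w_itv intf derf _ int_dom d1f_le)//.
rewrite -[RHS]mulN1r -RintegralZl//; last first.
  by apply: continuous_integrable_itv; exact: continuous_mul_sin.
by apply: eq_Rintegral => t _; rewrite d1f mulN1r.
Qed.

Lemma sum_mul_cos_transform0 (n : nat) (c w : 'I_n -> R) :
  (\sum_i c i) * cos_transform 0 =
  \int[mu]_(t in `[0, T]) (g t * \sum_i c i * (1 - cos (w i * t))) +
  \sum_i c i * cos_transform (w i).
Proof.
have cgB i : continuous (fun t => g t * cos (0 * t) - g t * cos (w i * t)).
  by move=> t; apply: cvgB; exact: continuous_mul_cos.
have -> : \int[mu]_(t in `[0, T]) (g t * \sum_i c i * (1 - cos (w i * t))) =
    \int[mu]_(t in `[0, T])
      \sum_i c i * (g t * cos (0 * t) - g t * cos (w i * t)).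
  apply: eq_Rintegral => t _; rewrite mulr_sumr; apply: eq_bigr => i _.
  by rewrite mul0r cos0; ring.
rewrite Rintegral_sum => [|i t]; last by apply: cvgM; [exact: cvg_cst|exact: cgB].
rewrite mulr_suml -big_split /=; apply: eq_bigr => i _.
rewrite RintegralZl//; last exact/continuous_integrable_itv/cgB.
rewrite RintegralB//; [|apply: continuous_integrable_itv; exact: continuous_mul_cos..].
by rewrite -!/(cos_transform _); ring.
Qed.

Lemma norm_sum_mul_cos_transform0_le (n : nat) (c w : 'I_n -> R) (M : R) : 0 <= T ->
  (forall t, 0 <= t <= T -> `|g t * \sum_i c i * (1 - cos (w i * t))| <= M) ->
  `|(\sum_i c i) * cos_transform 0| <= M * T + \sum_i `|c i| * `|cos_transform (w i)|.
Proof.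
move=> T0 gM; rewrite (sum_mul_cos_transform0 c w).
apply: (le_trans (ler_normD _ _)); apply: lerD.
  rewrite -[X in M * X]subr0; apply: norm_Rintegral_itv_le => // t.
  apply: cvgM; first exact: cg.
  apply: (continuous_sum (f := fun i t => c i * (1 - cos (w i * t)))) => i.
  by apply: (@is_derive_continuous _ (fun t => c i * (1 - cos (w i * t)))).
by apply: (le_trans (ler_norm_sum _ _ _)); apply: ler_sum => i _; rewrite normrM.
Qed.

End time_filter.

Lemma norm_sum_1Bcos_le (R : realType) (n d : nat) (x w : 'I_n -> R) (K T t : R) :
  0 < T -> 0 <= t <= T ->
  (forall s, 0 <= s <= T -> `|\sum_i x i * sin (w i * s)| <= K * (s / T) ^+ d) ->
  `|\sum_i x i / w i * (1 - cos (w i * t))| <= K * T / d.+1%:R * (t / T) ^+ d.+1.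
Proof.
move=> T0 /andP[t0 tT] sin_le.
pose P s := \sum_i x i / w i * (1 - cos (w i * s)).
pose Q s := K * T / d.+1%:R * (s / T) ^+ d.+1.
have dP (s : R) : is_derive s 1 P (\sum_i x i * sin (w i * s)).
  have -> : P = \sum_i (fun s => x i / w i * (1 - cos (w i * s))).
    by apply/funext => u; rewrite fct_sumE.
  apply: is_derive_sum => i; apply: is_derive_eq.
  simpl_derive; have [->|w0] := eqVneq (w i) 0; first by rewrite !mul0r sin0; ring.
  by field.
have dQ (s : R) : is_derive s 1 Q (K * (s / T) ^+ d).
  have -> : Q = (K * T / d.+1%:R) \*: ((fun u : R => u / T) ^+ d.+1).
    by apply/funext => u; rewrite /Q /= exprfctE.
  have ddiv : is_derive s 1 (fun u : R => u / T) T^-1.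
    by apply: is_derive_eq; simpl_derive; rewrite mulr1.
  apply: is_derive_eq; rewrite /GRing.scale /=.
  have : d.+1%:R != 0 :> R by rewrite pnatr_eq0.
  by move: (d.+1%:R : R) ((s / T) ^+ d) => N p N0; field; rewrite N0; lra.
have := normB_le_derive t0 dP dQ; rewrite /Q mul0r expr0n mulr0 subr0.
rewrite [P 0]big1 ?subr0; last by move=> i _; rewrite mulr0 cos0 subrr mulr0.
by apply=> s /andP[s0 st]; apply: sin_le; rewrite s0 (le_trans st).
Qed.

(** * The truncated Gaussian filter *)

Section gaussian.
Local Open Scope classical_set_scope.
Variable R : realType.
Implicit Types a s t w T : R.
Notation mu := (@lebesgue_measure R).

Definition gaussian a t : R := expR (- (a * t ^+ 2)).

Lemma gaussian_gt0 a t : 0 < gaussian a t.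
Proof. exact: expR_gt0. Qed.

Lemma is_derive_gaussian a t :
  is_derive t 1 (gaussian a) (- (2 * a) * (t * gaussian a t)).
Proof.
rewrite /gaussian; apply: is_derive_eq.
simpl_derive; ring.
Qed.

Lemma continuous_gaussian a : continuous (gaussian a).
Proof. exact: is_derive_continuous (@is_derive_gaussian a). Qed.

Lemma le_gaussian a s t : 0 <= a -> 0 <= s <= t -> gaussian a t <= gaussian a s.
Proof.
move=> a0 /andP[s0 st]; rewrite ler_expR lerN2 ler_wpM2l// lerXn2r// nnegrE//.
exact: le_trans st.
Qed.

Lemma mul_gaussian_le_cos_transform0 a T t : 0 <= a -> 0 <= t <= T ->
  t * gaussian a t <= cos_transform (gaussian a) T 0.
Proof.
move=> a0 /andP[t0 tT]; have cg := @continuous_gaussian a.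
have cgc := @continuous_mul_cos _ _ cg 0.
have := @Rintegral_itvB _ _ (BLeft 0) (BRight T) t (continuous_integrable_itv 0 T cgc).
rewrite !bnd_simp => /(_ t0 tT) split_itv.
apply: (le_trans (y := cos_transform (gaussian a) t 0)).
  rewrite -[t in t * _]subr0 mulrC -Rintegral_itv_cst//.
  apply: le_Rintegral_continuous => // [u|u u0t]; first exact: cvg_cst.
  by rewrite mul0r cos0 mulr1 le_gaussian.
rewrite -subr_ge0 split_itv; apply: Rintegral_ge0 => u _.
by rewrite mul0r cos0 mulr1 ltW ?gaussian_gt0.
Qed.

Lemma cos_transform_gaussian0_ge0 a T : 0 <= a -> 0 <= T ->
  0 <= cos_transform (gaussian a) T 0.
Proof.
move=> a0 T0; have := @mul_gaussian_le_cos_transform0 a T 0 a0.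
by rewrite mul0r lexx T0; exact.
Qed.

Lemma gaussian_by_parts a T w : 0 < T ->
  2 * a * sin_moment (gaussian a) T w =
  w * cos_transform (gaussian a) T w - gaussian a T * sin (w * T).
Proof.
move=> T0; have cg := @continuous_gaussian a.
have dsin t : is_derive t 1 (fun u => sin (w * u)) (w * cos (w * t)).
  by apply: is_derive_eq; simpl_derive; ring.
have dg := @is_derive_gaussian a.
have cwcos : continuous (fun t => w * cos (w * t)).
  by apply: (@is_derive_continuous _ (fun t => w * cos (w * t))).
have cdg : continuous (fun t => - (2 * a) * (t * gaussian a t)).
  move=> t; apply: cvgM; first exact: cvg_cst.
  by apply: cvgM; [exact: cvg_id|exact: cg].
have derive1_sin : {in `]0, T[%R, (fun u => sin (w * u))^`() =1 fun t => w * cos (w * t)}.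
  by move=> t _; rewrite derive1E; exact: derive_val.
have derive1_g : {in `]0, T[%R, (gaussian a)^`() =1 fun t => - (2 * a) * (t * gaussian a t)}.
  by move=> t _; rewrite derive1E; exact: derive_val.
have := Rintegration_by_parts T0 (continuous_subspaceT cwcos)
  (is_derive_LRcontinuous 0 T dsin) derive1_sin (continuous_subspaceT cdg)
  (is_derive_LRcontinuous 0 T dg) derive1_g.
have -> : \int[mu]_(t in `[0, T]) (sin (w * t) * (- (2 * a) * (t * gaussian a t))) =
    - (2 * a) * sin_moment (gaussian a) T w.
  rewrite -RintegralZl//; first by apply: eq_Rintegral => t _; ring.
  by apply: continuous_integrable_itv; exact: continuous_mul_sin.
have -> : \int[mu]_(t in `[0, T]) (w * cos (w * t) * gaussian a t) =
    w * cos_transform (gaussian a) T w.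
  rewrite -RintegralZl//; first by apply: eq_Rintegral => t _; ring.
  by apply: continuous_integrable_itv; exact: continuous_mul_cos.
by rewrite mulr0 sin0; lra.
Qed.

(* By parts, [phi := cos_transform (gaussian a) T] solves [phi' = - w phi / 2a] up to
   a boundary term at [T], and [exp (w^2 / 4a)] is the integrating factor. *)
Lemma is_derive_expR_mul_cos_transform a T w : 0 < a -> 0 < T ->
  is_derive w 1 (fun s => expR (s ^+ 2 / (4 * a)) * cos_transform (gaussian a) T s)
    (expR (w ^+ 2 / (4 * a)) * (gaussian a T * sin (w * T)) / (2 * a)).
Proof.
move=> a0 T0.
have dphi := @is_derive_cos_transform _ _ T (@continuous_gaussian a) w.
have by_parts := @gaussian_by_parts a T w T0.
have {}by_parts : sin_moment (gaussian a) T w =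
    (w * cos_transform (gaussian a) T w - gaussian a T * sin (w * T)) / (2 * a).
  by rewrite -by_parts; field; lra.
rewrite by_parts in dphi; apply: is_derive_eq.
simpl_derive; field; lra.
Qed.

Lemma norm_cos_transform_gaussian_le a T w : 0 < a -> 0 < T -> 0 < w ->
  `|cos_transform (gaussian a) T w| <=
  expR (- (w ^+ 2 / (4 * a))) * cos_transform (gaussian a) T 0 +
  2 / w * gaussian a T.
Proof.
move=> a0 T0 w0; set phi := cos_transform _ T.
pose bound s := 2 / w * gaussian a T * expR (w * s / (4 * a)).
pose dbound s := gaussian a T / (2 * a) * expR (w * s / (4 * a)).
have dboundP s : is_derive s 1 bound (dbound s).
  by apply: is_derive_eq; simpl_derive; rewrite /dbound; field; lra.
have le_dbound s : 0 <= s <= w ->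
    `|expR (s ^+ 2 / (4 * a)) * (gaussian a T * sin (s * T)) / (2 * a)| <= dbound s.
  move=> /andP[s0 sw]; have prefactor_ge0 : 0 <= gaussian a T / (2 * a).
    by rewrite divr_ge0 ?mulr_ge0 ?(ltW a0) ?(ltW (gaussian_gt0 _ _)).
  rewrite [X in `|X|](_ : _ = gaussian a T / (2 * a) *
    (expR (s ^+ 2 / (4 * a)) * sin (s * T))); last by ring.
  rewrite normrM ger0_norm// ler_wpM2l// normrM gtr0_norm ?expR_gt0//.
  apply: (le_trans (y := expR (s ^+ 2 / (4 * a)))).
    by rewrite ler_piMr ?expR_ge0// ler_norml sin_geN1 sin_le1.
  by rewrite ler_expR expr2 ler_wpM2r ?ler_wpM2r// invr_ge0 mulr_ge0// ltW.
have := normB_le_derive (ltW w0)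
  (fun s => @is_derive_expR_mul_cos_transform a T s a0 T0) dboundP le_dbound.
rewrite -/phi expr0n mul0r expR0 mul1r => variation.
have phi0_ge0 : 0 <= phi 0 := cos_transform_gaussian0_ge0 (ltW a0) (ltW T0).
have bound0 : 0 <= bound 0.
  by rewrite !mulr_ge0 ?expR_ge0 ?invr_ge0 ?(ltW w0) ?(ltW (gaussian_gt0 _ _)).
have boundw : bound w = expR (w ^+ 2 / (4 * a)) * (2 / w * gaussian a T).
  by rewrite /bound -expr2 mulrC.
rewrite -(ler_pM2l (expR_gt0 (w ^+ 2 / (4 * a)))) mulrDr mulrA -expRD subrr expR0 mul1r.
rewrite -boundw -[X in X * `|_|](gtr0_norm (expR_gt0 _)) -normrM.
have := ler_normD (expR (w ^+ 2 / (4 * a)) * phi w - phi 0) (phi 0).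
by rewrite subrK (ger0_norm phi0_ge0); lra.
Qed.

Lemma norm_cos_transform_gaussian_gap_le a T w Delta : 0 < a -> 0 < T ->
  0 < Delta <= w ->
  `|cos_transform (gaussian a) T w| <=
  expR (- (Delta ^+ 2 / (4 * a))) * cos_transform (gaussian a) T 0 +
  2 / Delta * gaussian a T.
Proof.
move=> a0 T0 /andP[D0 Dw]; have w0 := lt_le_trans D0 Dw.
apply: (le_trans (norm_cos_transform_gaussian_le a0 T0 w0)); apply: lerD.
  rewrite ler_wpM2r ?cos_transform_gaussian0_ge0 ?(ltW a0) ?(ltW T0)//.
  rewrite ler_expR lerN2 ler_pM2r ?invr_gt0 ?mulr_gt0//.
  by rewrite lerXn2r ?nnegrE ?(ltW D0) ?(ltW w0).
by rewrite ler_wpM2r ?(ltW (gaussian_gt0 _ _))// ler_pM2l// lef_pV2 ?posrE.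
Qed.

Lemma norm_sum_div_gaussian_le (n d : nat) (x w : 'I_n -> R)
    (Delta K a T eps : R) :
  0 < Delta -> 0 <= K -> 0 < a -> 0 < T -> (forall i, Delta <= w i) ->
  (forall s, 0 <= s <= T -> `|\sum_i x i * sin (w i * s)| <= K * (s / T) ^+ d) ->
  (forall t, 0 <= t <= T -> gaussian a t * (t / T) ^+ d.+1 <= eps) ->
  expR (- (Delta ^+ 2 / (4 * a))) <= eps ->
  `|\sum_i x i / w i| * cos_transform (gaussian a) T 0 <=
  eps * (K * T ^+ 2 / d.+1%:R +
    (\sum_i `|x i|) / Delta * (cos_transform (gaussian a) T 0 + 2 / Delta)).
Proof.
move=> D0 K0 a0 T0 Dw sin_le eps_time eps_gap; set phi := cos_transform _ _.
have w0 i : 0 < w i by rewrite (lt_le_trans D0).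
have phi0_ge0 : 0 <= phi 0 := cos_transform_gaussian0_ge0 (ltW a0) (ltW T0).
have eps_end : gaussian a T <= eps.
  by have := eps_time T; rewrite divff ?gt_eqF// expr1n mulr1 lexx ltW//; exact.
have filtered_le t : 0 <= t <= T ->
    `|gaussian a t * \sum_i x i / w i * (1 - cos (w i * t))| <= K * T / d.+1%:R * eps.
  move=> t0T; rewrite normrM (gtr0_norm (gaussian_gt0 _ _)).
  apply: (le_trans (ler_wpM2l (ltW (gaussian_gt0 a t)) (norm_sum_1Bcos_le T0 t0T sin_le))).
  by rewrite mulrCA ler_wpM2l ?eps_time// divr_ge0 ?mulr_ge0 ?(ltW T0).
have phi_le i : `|phi (w i)| <= eps * (phi 0 + 2 / Delta).
  have D0w : 0 < Delta <= w i by rewrite D0 Dw.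
  apply: (le_trans (norm_cos_transform_gaussian_gap_le a0 T0 D0w)).
  by rewrite mulrDr [eps * (2 / _)]mulrC lerD ?ler_wpM2r ?ler_wpM2l ?divr_ge0 ?(ltW D0).
rewrite -[X in _ * X](ger0_norm phi0_ge0) -normrM.
have cg := @continuous_gaussian a.
apply: (le_trans (norm_sum_mul_cos_transform0_le cg (ltW T0) filtered_le)).
rewrite mulrDr lerD//.
  by rewrite [leLHS](_ : _ = eps * (K * T ^+ 2 / d.+1%:R))//; ring.
rewrite mulrCA mulr_suml [leRHS]mulr_suml; apply: ler_sum => i _.
rewrite normf_div (gtr0_norm (w0 i)) ler_pM ?divr_ge0 ?(ltW (w0 i))//.
by rewrite ler_wpM2l// lef_pV2 ?posrE.
Qed.

End gaussian.

(** * The decay rate *)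

Section decay_rate.
Local Open Scope classical_set_scope.
Variable R : realType.
Implicit Types X Delta v y th t : R.

Definition light_cone_time v (d : nat) : R := d%:R / v.

Definition filter_rate v y (d : nat) : R := y * v ^+ 2 / (2 * d%:R).

(* For these [th], the filter [gaussian (filter_rate v y d)] on [[0, light_cone_time v d]]
   makes both the spectral tail above the gap and the Lieb-Robinson error
   [O(expR (- (d * th)))]; in the last condition, [s] is [t / light_cone_time v d]. *)
Definition admissible_rate Delta v y th : Prop :=
  [/\ 0 < y, th <= Delta ^+ 2 / (2 * y * v ^+ 2) &
      forall s : R, 0 <= s <= 1 -> s * expR (- (y * s ^+ 2 / 2)) <= expR (- th)].

Lemma lambertW_mul_expR X : 0 <= X -> lambertW X * expR (lambertW X) = X.
Proof.
move=> X0.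
have [w] : exists2 w : R, w \in `[0, X]%R & w * expR w = X.
  apply: (@IVT R (fun w : R => w * expR w)) => //.
    by apply/continuous_subspaceT/is_derive_continuous.
  rewrite mul0r min_l ?max_r ?mulr_ge0 ?expR_ge0//.
  by rewrite X0 ler_peMr// -expR0 ler_expR.
rewrite in_itv /= => /andP[w0 _] wX.
suff -> : lambertW X = w by [].
have w_ub : ubound [set u : R | 0 <= u /\ u * expR u <= X] w.
  move=> u [u0]; apply: contra_le => wu.
  by rewrite -wX ltr_pM ?expR_ge0 ?ltr_expR.
apply/le_anti/andP; split; first by apply: ge_sup => //; exists 0; rewrite /= mul0r.
by apply: ub_le_sup; [exists w|rewrite /= wX].
Qed.

Lemma admissible_rate_small_gap Delta v : 0 < Delta <= v ->
  admissible_rate Delta v (Delta / v) (Delta / (2 * v)).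
Proof.
move=> /andP[D0 Dv]; have v0 := lt_le_trans D0 Dv.
set y := Delta / v; have y0 : 0 < y by rewrite divr_gt0.
have y1 : y <= 1 by rewrite ler_pdivrMr// mul1r.
have -> : Delta / (2 * v) = y / 2 by rewrite /y; field; lra.
split=> // [|s /andP[s0 s1]].
  by rewrite [leRHS](_ : _ = y / 2)// /y; field; lra.
rewrite -ler_pdivlMr ?expR_gt0// -expRN -expRD.
have s2_le : s ^+ 2 <= expR (s ^+ 2 - 1) by apply: le_trans (expR_ge1Dx _); lra.
have s_le : s <= expR ((s ^+ 2 - 1) / 2).
  rewrite -(@ler_pXn2r _ 2) ?nnegrE ?expR_ge0// -expRM_natl.
  by apply: (le_trans s2_le); rewrite ler_expR; lra.
apply: (le_trans s_le); rewrite ler_expR.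
have := @mulr_ge0 _ (1 - s ^+ 2) (1 - y).
by rewrite !subr_ge0 expr_le1// y1 s1 => /(_ isT isT); lra.
Qed.

(* The width [y = expR (W - 1)] balances the gap error with the maximum
   [1 / sqrt (y e)] of [s * expR (- (y * s ^+ 2 / 2))]. *)
Lemma admissible_rate_large_gap Delta v W : 0 < v ->
  W * expR W <= Delta ^+ 2 * expR 1 / v ^+ 2 ->
  admissible_rate Delta v (expR (W - 1)) (W / 2).
Proof.
move=> v0 W_le; set y := expR (W - 1); have y0 : 0 < y := expR_gt0 _.
have yE : y * expR 1 = expR W by rewrite -expRD subrK.
split=> // [|s /andP[s0 _]].
  rewrite ler_pdivlMr ?mulr_gt0 ?exprn_gt0//.
  rewrite [leLHS](_ : _ = W * y * v ^+ 2); last by field.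
  rewrite -(ler_pM2r (expR_gt0 1)) [leLHS](_ : _ = W * expR W * v ^+ 2); last first.
    by rewrite -yE; ring.
  by rewrite -ler_pdivlMr ?exprn_gt0.
rewrite -(@ler_pXn2r _ 2) ?nnegrE ?mulr_ge0 ?expR_ge0// exprMn -!expRM_natl.
have -> : 2 * - (y * s ^+ 2 / 2) = - (y * s ^+ 2) by lra.
have -> : 2 * - (W / 2) = - W by lra.
rewrite !expRN ler_pdivrMr ?expR_gt0// mulrC ler_pdivlMr ?expR_gt0// -yE.
rewrite mulrA -ler_pdivlMr ?expR_gt0// -expRB mulrC.
by apply: le_trans (expR_ge1Dx _); lra.
Qed.

Lemma admissible_xi_inv Delta v : 0 < Delta -> 0 < v ->
  exists y, admissible_rate Delta v y (xi_inv Delta v).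
Proof.
move=> D0 v0; rewrite /xi_inv; case: ifPn => [Dv|_].
  by exists (Delta / v); apply: admissible_rate_small_gap; rewrite D0.
set X := _ / v ^+ 2.
have X0 : 0 <= X by rewrite !mulr_ge0 ?invr_ge0 ?expR_ge0 ?exprn_ge0 ?(ltW D0) ?(ltW v0).
exists (expR (lambertW X - 1)); apply: admissible_rate_large_gap => //.
by rewrite lambertW_mul_expR.
Qed.

Lemma light_cone_time_sqr_div_le v d :
  light_cone_time v d ^+ 2 / d.+2%:R <= d%:R / v ^+ 2.
Proof.
rewrite /light_cone_time expr_div_n mulrAC ler_wpM2r ?invr_ge0 ?sqr_ge0//.
rewrite ler_pdivrMr ?ltr0n// expr2 ler_wpM2l ?ler0n// ler_nat.
exact: leqW (leqnSn d).
Qed.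

Section light_cone.
Variables (Delta v y th : R) (d : nat).
Hypotheses (v0 : 0 < v) (d0 : (0 < d)%N).
Hypothesis adm : admissible_rate Delta v y th.

Let dR_gt0 : 0 < d%:R :> R. Proof. by rewrite ltr0n. Qed.

Lemma light_cone_time_gt0 : 0 < light_cone_time v d.
Proof. exact: divr_gt0. Qed.

Lemma filter_rate_gt0 : 0 < filter_rate v y d.
Proof. by case: adm => y0 _ _; rewrite divr_gt0 ?mulr_gt0 ?exprn_gt0. Qed.

Lemma filter_gap_error :
  expR (- (Delta ^+ 2 / (4 * filter_rate v y d))) <= expR (- (d%:R * th)).
Proof.
case: adm => y0 th_gap _; rewrite ler_expR lerN2.
rewrite [leRHS](_ : _ = d%:R * (Delta ^+ 2 / (2 * y * v ^+ 2))).
  by rewrite ler_pM2l.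
by rewrite /filter_rate; field; move: dR_gt0 v0 y0; lra.
Qed.

Lemma filter_light_cone_error t : 0 <= t <= light_cone_time v d ->
  gaussian (filter_rate v y d) t * (t / light_cone_time v d) ^+ d.+2 <=
  expR (- (d%:R * th)).
Proof.
case: adm => y0 _ th_time /andP[t0 tT]; have T0 := light_cone_time_gt0.
set s := t / _.
have s0 : 0 <= s by rewrite divr_ge0// ltW.
have s1 : s <= 1 by rewrite ler_pdivrMr// mul1r.
have gaussianE : gaussian (filter_rate v y d) t = expR (- (y * s ^+ 2 / 2)) ^+ d.
  rewrite -expRM_natl /gaussian /s /filter_rate /light_cone_time; congr expR.
  by field; move: dR_gt0 v0; lra.
have sg0 : 0 <= s * expR (- (y * s ^+ 2 / 2)) by rewrite mulr_ge0 ?expR_ge0.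
rewrite gaussianE -[d.+2]addn2 exprD mulrA -exprMn [expR _ * s]mulrC.
apply: (le_trans (y := (s * expR (- (y * s ^+ 2 / 2))) ^+ d)).
  by rewrite ler_piMr ?exprn_ge0 ?exprn_ile1.
rewrite -(mulrN d%:R) expRM_natl lerXn2r ?nnegrE ?expR_ge0//.
by apply: th_time; rewrite s0.
Qed.

Lemma filter_mass_lower_bound : Num.sqrt d%:R / v <=
  cos_transform (gaussian (filter_rate v y d)) (light_cone_time v d) 0 * expR (y / 2).
Proof.
case: adm => y0 _ _; set r := Num.sqrt _.
have rq : r ^+ 2 = d%:R by rewrite sqr_sqrtr// ltW.
have r1 : 1 <= r by rewrite -sqrtr1 ler_sqrt ?ler1n.
rewrite -ler_pdivrMr ?expR_gt0// -expRN.
have -> : expR (- (y / 2)) = gaussian (filter_rate v y d) (r / v).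
  rewrite /gaussian exprMn rq /filter_rate; congr expR.
  by field; move: dR_gt0 v0; lra.
apply: mul_gaussian_le_cos_transform0; first exact: ltW filter_rate_gt0.
rewrite divr_ge0 ?sqrtr_ge0 ?(ltW v0)//= ler_pM2r ?invr_gt0// -rq expr2.
by rewrite ler_peMr// (le_trans _ r1).
Qed.

End light_cone.

Definition clustering_const Delta v y K S : R :=
  (Delta^-1 + 2 * v * expR (y / 2) / Delta ^+ 2) * S + K * v^-1 * expR (y / 2).

Lemma norm_sum_div_light_cone_le (n d : nat) (x w : 'I_n -> R) Delta v y th K S :
  0 < Delta -> 0 < v -> 0 <= K -> (0 < d)%N -> admissible_rate Delta v y th ->
  (forall i, Delta <= w i) -> \sum_i `|x i| <= S ->
  (forall t, 0 <= t <= light_cone_time v d ->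
    `|\sum_i x i * sin (w i * t)| <= K * (t / light_cone_time v d) ^+ d.+1) ->
  `|\sum_i x i / w i| <=
  clustering_const Delta v y K S * Num.sqrt d%:R * expR (- (d%:R * th)).
Proof.
move=> D0 v0 K0 d0 adm Dw xS sin_le.
have T0 := light_cone_time_gt0 v0 d0; have a0 := filter_rate_gt0 v0 d0 adm.
have filtered := norm_sum_div_gaussian_le D0 K0 a0 T0 Dw sin_le
  (filter_light_cone_error v0 d0 adm) (filter_gap_error v0 d0 adm).
have mass := filter_mass_lower_bound v0 d0 adm.
move: filtered mass; set phi0 := cos_transform _ _ _.
set r := Num.sqrt _; set e := expR (- _); set E := expR _ => filtered mass.
have rq : r ^+ 2 = d%:R by rewrite sqr_sqrtr.
have r1 : 1 <= r by rewrite -sqrtr1 ler_sqrt ?ler1n ?ltr0n.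
have r0 : 0 < r := lt_le_trans ltr01 r1.
have phi0_gt0 : 0 < phi0.
  by rewrite -(pmulr_lgt0 _ (expR_gt0 (y / 2))) (lt_le_trans _ mass)// divr_gt0.
pose light_mass := phi0 * E * v * r.
have d_le_mass : d%:R <= light_mass by rewrite -rq expr2 ler_pM2r// -ler_pdivrMr.
have T2_le : light_cone_time v d ^+ 2 / d.+2%:R <= light_mass / v ^+ 2.
  apply: (le_trans (light_cone_time_sqr_div_le v d)).
  by rewrite ler_wpM2r ?invr_ge0 ?sqr_ge0.
rewrite -(ler_pM2r phi0_gt0); apply: (le_trans filtered).
rewrite [leRHS](_ : _ = e * (K * (light_mass / v ^+ 2) +
  S / Delta * (phi0 * r + 2 / Delta * light_mass))); last first.
  by rewrite /clustering_const -/E /light_mass; field; lra.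
rewrite ler_wpM2l ?expR_ge0//; apply: lerD; first by rewrite -mulrA ler_wpM2l.
have gap_ge0 : 0 <= 2 / Delta by rewrite divr_ge0 ?(ltW D0).
apply: ler_pM; rewrite ?divr_ge0 ?addr_ge0 ?sumr_ge0 ?(ltW D0) ?(ltW phi0_gt0)//.
  by rewrite ler_wpM2r ?invr_ge0 ?(ltW D0).
apply: lerD; first by rewrite ler_peMr// ltW.
by rewrite ler_peMr// (le_trans _ d_le_mass)// ler1n.
Qed.

End decay_rate.

(** * Matrix elements in the energy eigenbasis *)

Section operators.
Variable R : realType.
Notation C := R[i].
Implicit Types (z : C) (m n p : nat).

Lemma sqr_cabs z : cabs z ^+ 2 = complex.Re z ^+ 2 + complex.Im z ^+ 2.
Proof. by rewrite sqr_sqrtr// addr_ge0 ?sqr_ge0. Qed.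

Lemma cabs_ge0 z : 0 <= cabs z.
Proof. exact: sqrtr_ge0. Qed.

Lemma cabsE z : (cabs z)%:C = `|z|.
Proof. by rewrite normc_def. Qed.

Lemma cabsM z1 z2 : cabs (z1 * z2) = cabs z1 * cabs z2.
Proof. by apply: complexI; rewrite rmorphM /= !cabsE normrM. Qed.

Lemma cabs_conj z : cabs z^* = cabs z.
Proof. by case: z => x y; rewrite /cabs /= sqrrN. Qed.

Lemma mul_conjc_cabs z : z^* * z = (cabs z ^+ 2)%:C.
Proof. by rewrite sqr_cabs; case: z => x y /=; simpc; congr (_ +i* _); ring. Qed.

Lemma cabs_sum (I : finType) (f : I -> C) : cabs (\sum_i f i) <= \sum_i cabs (f i).
Proof.
rewrite -lecR cabsE rmorph_sum /=; apply: (le_trans (ler_norm_sum _ _ _)).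
by apply: ler_sum => i _; rewrite cabsE.
Qed.

Lemma norm_Re_le_cabs z : `|complex.Re z| <= cabs z.
Proof. by rewrite -sqrtr_sqr ler_wsqrtr// lerDl sqr_ge0. Qed.

Lemma norm_Im_le_cabs z : `|complex.Im z| <= cabs z.
Proof. by rewrite -sqrtr_sqr ler_wsqrtr// lerDr sqr_ge0. Qed.

Lemma Re_sum (I : finType) (f : I -> C) :
  complex.Re (\sum_i f i) = \sum_i complex.Re (f i).
Proof. exact: (raddf_sum (@complex.Re R : Rcomplex R -> R)). Qed.

Lemma Im_sum (I : finType) (f : I -> C) :
  complex.Im (\sum_i f i) = \sum_i complex.Im (f i).
Proof. exact: (raddf_sum (@complex.Im R : Rcomplex R -> R)). Qed.

Lemma Re_mul_real z (r : R) : complex.Re (z * r%:C) = complex.Re z * r.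
Proof. by case: z => x y; simpc. Qed.

Lemma cexpiN (th : R) : cexpi (- th) = (cexpi th)^*.
Proof. by rewrite /cexpi cosN sinN. Qed.

Lemma cexpiD (th ph : R) : cexpi (th + ph) = cexpi th * cexpi ph.
Proof. by rewrite /cexpi cosD sinD; simpc; congr (_ +i* _); ring. Qed.

Lemma Im_mul_cexpiB z (th : R) :
  complex.Im (z * cexpi th) - complex.Im (z * cexpi (- th)) =
  2 * (complex.Re z * sin th).
Proof. by rewrite cexpiN /cexpi; case: z => x y; simpc => /=; ring. Qed.

Lemma sqr_vnorm n (x : 'cV[C]_n) : vnorm x ^+ 2 = \sum_i cabs (x i 0) ^+ 2.
Proof.
rewrite sqr_sqrtr; last by apply: sumr_ge0 => i _; rewrite addr_ge0 ?sqr_ge0.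
by apply: eq_bigr => i _; rewrite sqr_cabs.
Qed.

Lemma vnorm_ge0 n (x : 'cV[C]_n) : 0 <= vnorm x.
Proof. exact: sqrtr_ge0. Qed.

Lemma vnorm0 n : vnorm (0 : 'cV[C]_n) = 0.
Proof. by rewrite /vnorm big1 ?sqrtr0// => i _; rewrite mxE /= expr0n addr0. Qed.

Lemma cabs_le_vnorm n (x : 'cV[C]_n) i : cabs (x i 0) <= vnorm x.
Proof.
by rewrite ler_wsqrtr// (bigD1 i)//= lerDl sumr_ge0// => j _; rewrite addr_ge0 ?sqr_ge0.
Qed.

Lemma mxadjM m n p (M : 'M[C]_(m, n)) (N : 'M[C]_(n, p)) :
  mxadj (M *m N) = mxadj N *m mxadj M.
Proof. by rewrite /mxadj map_mxM trmx_mul. Qed.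

Lemma mxadjK m n (M : 'M[C]_(m, n)) : mxadj (mxadj M) = M.
Proof. by apply/matrixP => i j; rewrite !mxE conjcK. Qed.

Lemma mxadj_mul_self n (x : 'cV[C]_n) : (mxadj x *m x) 0 0 = (vnorm x ^+ 2)%:C.
Proof.
rewrite sqr_vnorm mxE rmorph_sum /=; apply: eq_bigr => i _.
by rewrite !mxE mul_conjc_cabs.
Qed.

Lemma hermitian_mxE n (M : 'M[C]_n) i j : hermitian_mx M -> M i j = (M j i)^*.
Proof. by move=> {1}<-; rewrite !mxE. Qed.

Lemma vnorm_mxadj_unitary n (U : 'M[C]_n) (x : 'cV[C]_n) :
  unitary_mx U -> vnorm (mxadj U *m x) = vnorm x.
Proof.
move=> UU; apply/eqP; rewrite -(@eqrXn2 _ 2) ?vnorm_ge0//; apply/eqP.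
by apply: complexI; rewrite -!mxadj_mul_self mxadjM mxadjK -mulmxA (mulmxA U) UU mul1mx.
Qed.

Lemma vnorm_le_opnorm n (M : 'M[C]_n) (x : 'cV[C]_n) :
  vnorm x <= 1 -> vnorm (M *m x) <= opnorm M.
Proof.
move=> x1; apply: ub_le_sup; last by exists x.
exists (Num.sqrt (\sum_i (\sum_j cabs (M i j)) ^+ 2)) => _ [y [y1 ->]].
apply: ler_wsqrtr; apply: ler_sum => i _.
rewrite -sqr_cabs lerXn2r ?nnegrE ?cabs_ge0 ?sumr_ge0// => [j _|].
  exact: cabs_ge0.
rewrite mxE; apply: (le_trans (cabs_sum _)); apply: ler_sum => j _.
by rewrite cabsM ler_piMr ?cabs_ge0// (le_trans (cabs_le_vnorm _ _)).
Qed.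

Lemma opnorm_ge0 n (M : 'M[C]_n) : 0 <= opnorm M.
Proof. by have := @vnorm_le_opnorm n M 0; rewrite mulmx0 vnorm0; apply. Qed.

End operators.

Section eigenbasis.
Variables (R : realType) (n : nat) (U : 'M[R[i]]_n).
Hypothesis unitU : unitary_mx U.
Notation C := R[i].
Implicit Types (M N A B : 'M[C]_n) (E : 'I_n -> R).

Definition eigenbasis_mx M : 'M[C]_n := mxadj U *m M *m U.

Let mulUadjU : mxadj U *m U = 1%:M. Proof. exact: mulmx1C. Qed.

Lemma eigenbasis_mxM M N : eigenbasis_mx (M *m N) = eigenbasis_mx M *m eigenbasis_mx N.
Proof. by rewrite /eigenbasis_mx !mulmxA -(mulmxA _ U) unitU mulmx1. Qed.

Lemma eigenbasis_fcalc (g : 'I_n -> C) : eigenbasis_mx (fcalc U g) = diag_mx (\row_k g k).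
Proof. by rewrite /eigenbasis_mx /fcalc !mulmxA mulUadjU mul1mx -mulmxA mulUadjU mulmx1. Qed.

Lemma eigenbasis_hermitian M : hermitian_mx M -> hermitian_mx (eigenbasis_mx M).
Proof. by rewrite /hermitian_mx /eigenbasis_mx !mxadjM mxadjK => ->; rewrite mulmxA. Qed.

Lemma eigenbasis_heis E t A i j :
  eigenbasis_mx (heis U E t A) i j = cexpi ((E i - E j) * t) * eigenbasis_mx A i j.
Proof.
rewrite /heis 2!eigenbasis_mxM !eigenbasis_fcalc mul_mx_diag mul_diag_mx !mxE.
by rewrite mulrBl cexpiD mulrAC.
Qed.

Lemma expect_col M k : expect (col k U) M = eigenbasis_mx M k k.
Proof.
rewrite /expect /eigenbasis_mx; have -> : mxadj (col k U) = row k (mxadj U).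
  by apply/matrixP => i j; rewrite !mxE.
by rewrite -row_mul !mxE; apply: eq_bigr => i _; rewrite !mxE.
Qed.

Lemma vnorm_col k : vnorm (col k U) = 1.
Proof.
apply/eqP; rewrite -(@eqrXn2 _ 2) ?vnorm_ge0// expr1n; apply/eqP; apply: complexI.
transitivity ((mxadj U *m U) k k); last by rewrite mulUadjU mxE eqxx.
by rewrite -mxadj_mul_self !mxE; apply: eq_bigr => i _; rewrite !mxE.
Qed.

Lemma sum_sqr_cabs_eigenbasis_le M k :
  \sum_i cabs (eigenbasis_mx M i k) ^+ 2 <= opnorm M ^+ 2.
Proof.
have col_eigenbasis : col k (eigenbasis_mx M) = mxadj U *m (M *m col k U).
  by rewrite /eigenbasis_mx !colE !mulmxA.
apply: (le_trans (y := vnorm (M *m col k U) ^+ 2)).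
  rewrite -(vnorm_mxadj_unitary _ unitU) -col_eigenbasis sqr_vnorm.
  by apply: ler_sum => i _; rewrite [col _ _ _ _]mxE.
by rewrite lerXn2r ?nnegrE ?vnorm_ge0 ?opnorm_ge0// vnorm_le_opnorm ?vnorm_col.
Qed.

Lemma cabs_expect_le_opnorm M k : cabs (expect (col k U) M) <= opnorm M.
Proof.
rewrite -(@ler_pXn2r _ 2) ?nnegrE ?cabs_ge0 ?opnorm_ge0// expect_col.
apply: le_trans (sum_sqr_cabs_eigenbasis_le M k).
by rewrite (bigD1 k)//= lerDl sumr_ge0// => i _; rewrite sqr_ge0.
Qed.

Lemma expect_fcalc A B (g : 'I_n -> C) j : expect (col j U) (A *m fcalc U g *m B) =
  \sum_k eigenbasis_mx A j k * eigenbasis_mx B k j * g k.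
Proof.
rewrite expect_col 2!eigenbasis_mxM eigenbasis_fcalc mxE.
by apply: eq_bigr => k _; rewrite mul_mx_diag !mxE mulrAC.
Qed.

Lemma Im_expect_commut_heis E A B t j : hermitian_mx A -> hermitian_mx B ->
  complex.Im (expect (col j U) (commut (heis U E t A) B)) =
  2 * \sum_k complex.Im (eigenbasis_mx A j k * eigenbasis_mx B k j *
                         cexpi (- ((E k - E j) * t))).
Proof.
move=> hA hB; pose f k := eigenbasis_mx A j k * eigenbasis_mx B k j *
  cexpi (- ((E k - E j) * t)).
have expect_mul : expect (col j U) (heis U E t A *m B) = \sum_k f k.
  rewrite expect_col eigenbasis_mxM mxE; apply: eq_bigr => k _.
  by rewrite eigenbasis_heis /f -mulNr opprB -mulrA mulrC.
have expect_mulC : expect (col j U) (B *m heis U E t A) = (\sum_k f k)^*.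
  rewrite expect_col eigenbasis_mxM mxE rmorph_sum; apply: eq_bigr => k _.
  rewrite eigenbasis_heis (hermitian_mxE k j (eigenbasis_hermitian hA)).
  rewrite (hermitian_mxE j k (eigenbasis_hermitian hB)) -[_ * t]opprK cexpiN.
  by rewrite -!rmorphM; congr (_^*); rewrite /f; ring.
have -> : expect (col j U) (commut (heis U E t A) B) =
    expect (col j U) (heis U E t A *m B) - expect (col j U) (B *m heis U E t A).
  by rewrite /expect /commut mulmxBr mulmxBl mxE [X in _ + X]mxE.
by rewrite expect_mul expect_mulC -Im_sum; case: (\sum_k _) => x y /=; ring.
Qed.

End eigenbasis.

Section ground_state.
Variables (R : realType) (n : nat) (U A B : 'M[R[i]]_n.+1) (E : 'I_n.+1 -> R).
Hypotheses (unitU : unitary_mx U) (hA : hermitian_mx A) (hB : hermitian_mx B).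

Definition excitation_energy (k : 'I_n) : R := E (lift ord0 k) - E ord0.

Definition spectral_weight (k : 'I_n) : R := complex.Re
  (eigenbasis_mx U A ord0 (lift ord0 k) * eigenbasis_mx U B (lift ord0 k) ord0).

Lemma cabs_fXY : cabs (fXY U E A B) =
  2 * `|\sum_k spectral_weight k / excitation_energy k|.
Proof.
rewrite /fXY /red_resolvent expect_fcalc//; set z := \sum_k _.
have -> : cabs (z + z^*) = 2 * `|complex.Re z|.
  case: z => x y; rewrite /cabs /= subrr expr0n addr0 sqrtr_sqr.
  have -> : x + x = 2 * x by ring.
  by rewrite normrM ger0_norm.
congr (_ * _); rewrite /z Re_sum big_ord_recl /= mulr0 add0r -normrN -sumrN.
congr (`| _ |); apply: eq_bigr => k _.
by rewrite Re_mul_real -mulrN -invrN opprB.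
Qed.

Lemma sum_norm_spectral_weight_le :
  \sum_k `|spectral_weight k| <= (opnorm A ^+ 2 + opnorm B ^+ 2) / 2.
Proof.
pose a k := cabs (eigenbasis_mx U A (lift ord0 k) ord0).
pose b k := cabs (eigenbasis_mx U B (lift ord0 k) ord0).
have weight_le k : `|spectral_weight k| <= (a k ^+ 2 + b k ^+ 2) / 2.
  apply: (le_trans (norm_Re_le_cabs _)); rewrite cabsM.
  rewrite (hermitian_mxE _ _ (eigenbasis_hermitian _ hA)) cabs_conj -/(a _) -/(b _).
  by have := sqr_ge0 (a k - b k); rewrite sqrrB; lra.
have excited_le M : \sum_k cabs (eigenbasis_mx U M (lift ord0 k) ord0) ^+ 2 <= opnorm M ^+ 2.
  apply: le_trans (sum_sqr_cabs_eigenbasis_le unitU M ord0).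
  by rewrite [leRHS]big_ord_recl lerDr sqr_ge0.
apply: (le_trans (ler_sum _ (fun k _ => weight_le k))).
by rewrite -mulr_suml ler_pM2r// big_split /=; apply: lerD; exact: excited_le.
Qed.

(* Antisymmetrizing in [t] isolates the real parts of the matrix elements, the only
   ones entering [fXY]. *)
Lemma sum_spectral_weight_sin t :
  4 * \sum_k spectral_weight k * sin (excitation_energy k * t) =
  complex.Im (expect (col ord0 U) (commut (heis U E (- t) A) B)) -
  complex.Im (expect (col ord0 U) (commut (heis U E t A) B)).
Proof.
pose c k := eigenbasis_mx U A ord0 k * eigenbasis_mx U B k ord0.
have sin_sum : \sum_k spectral_weight k * sin (excitation_energy k * t) =
    \sum_k complex.Re (c k) * sin ((E k - E ord0) * t).
  by rewrite [RHS]big_ord_recl subrr mul0r sin0 mulr0 add0r.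
have Im_commut s := Im_expect_commut_heis unitU E s ord0 hA hB.
rewrite sin_sum [X in X - _]Im_commut [X in _ - X]Im_commut.
rewrite -mulrBr -sumrB !mulr_sumr; apply: eq_bigr => k _.
by rewrite mulrN opprK Im_mul_cexpiB; ring.
Qed.

Lemma norm_sum_spectral_weight_sin_le t (b : R) :
  opnorm (commut (heis U E t A) B) <= b ->
  opnorm (commut (heis U E (- t) A) B) <= b ->
  `|\sum_k spectral_weight k * sin (excitation_energy k * t)| <= b / 2.
Proof.
move=> bt bNt.
have Im_le s : opnorm (commut (heis U E s A) B) <= b ->
    `|complex.Im (expect (col ord0 U) (commut (heis U E s A) B))| <= b.
  by apply: le_trans; exact: le_trans (norm_Im_le_cabs _) (cabs_expect_le_opnorm _ _ _).
have := le_trans (ler_normB _ _) (lerD (Im_le _ bNt) (Im_le _ bt)).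
by rewrite -sum_spectral_weight_sin normrM ger0_norm// => {bt bNt Im_le}; lra.
Qed.

Lemma norm_sum_spectral_weight_sin_light_cone_le (CLR v : R) d t : 0 < v ->
  (forall s : R, v * `|s| <= d%:R ->
    opnorm (commut (heis U E s A) B) <= CLR * (v * `|s| / d%:R) ^+ d.+1) ->
  0 <= t <= light_cone_time v d ->
  `|\sum_k spectral_weight k * sin (excitation_energy k * t)| <=
  CLR / 2 * (t / light_cone_time v d) ^+ d.+1.
Proof.
move=> v0 lieb_robinson /andP[t0 tT].
have -> : t / light_cone_time v d = v * t / d%:R.
  by rewrite /light_cone_time invf_div mulrCA mulrA.
have vt_le : v * t <= d%:R by rewrite mulrC -ler_pdivlMr.
rewrite mulrAC; apply: norm_sum_spectral_weight_sin_le.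
  by have := lieb_robinson t; rewrite ger0_norm//; exact.
by have := lieb_robinson (- t); rewrite normrN ger0_norm//; exact.
Qed.

End ground_state.

Theorem theorem1 (R : realType) (CLR v Delta : R) :
  0 < CLR -> 0 < v -> 0 < Delta ->
  exists Cst : R,
  forall (n : nat) (H U : 'M[R[i]]_n.+1) (E : 'I_n.+1 -> R)
         (A B : 'M[R[i]]_n.+1) (d : nat),
    (* H = U diag(E) U^dagger, with unique ground state |G> = U e_0 of energy
       E0 = E 0 and spectral gap Delta *)
    unitary_mx U ->
    H = fcalc U (fun k => (E k)%:C) ->
    (forall k : 'I_n.+1, k != ord0 -> E ord0 + Delta <= E k) ->
    (exists k : 'I_n.+1, k != ord0 /\ E k = E ord0 + Delta) ->
    (* normalized local observables *)
    hermitian_mx A -> hermitian_mx B ->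
    opnorm A = 1 -> opnorm B = 1 ->
    (* supports at distance d >= 1 *)
    (0 < d)%N ->
    (* Lieb-Robinson bound with velocity v *)
    (forall t : R, v * `|t| <= d%:R ->
        opnorm (commut (heis U E t A) B) <= CLR * (v * `|t| / d%:R) ^+ d.+1) ->
    cabs (fXY U E A B) <= Cst * Num.sqrt (d%:R) * expR (- (d%:R * xi_inv Delta v)).
Proof.
move=> CLR0 v0 D0; have [y adm] := admissible_xi_inv D0 v0.
exists (2 * clustering_const Delta v y (CLR / 2) 1).
move=> n H U E A B d unitU _ gap _ hA hB A1 B1 d0 lieb_robinson.
have gap_excitation k : Delta <= excitation_energy E k.
  by rewrite lerBrDl gap// eq_sym neq_lift.
have weights_le1 : \sum_k `|spectral_weight U A B k| <= 1.
  apply: le_trans (sum_norm_spectral_weight_le B unitU hA) _.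
  by rewrite A1 B1 expr1n; lra.
rewrite cabs_fXY// -!(mulrA 2) ler_pM2l//.
apply: norm_sum_div_light_cone_le => //; first by rewrite divr_ge0// ltW.
by move=> t; apply: norm_sum_spectral_weight_sin_light_cone_le.
Qed.
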